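(* Let $\Lambda\subset \mathrm{Ein}_2$ be a nonelementary generic closed achronal subset preserved by a discrete group $\Gamma\subset \mathrm{Isom}(\mathrm{AdS})$ (where $\mathrm{Isom}(\mathrm{AdS})=SO_0(2,2)$ is the group of isometries of $\mathrm{AdS}$ preserving orientation and time-orientation). Then the action of $\Gamma$ on the invisible domain $E(\Lambda)\subset \mathrm{AdS}$ is properly discontinuous.
   Context: Let $E=\mathbb R^4$ with coordinates $(u,v,x_1,x_2)$ and $Q=-u^2-v^2+x_1^2+x_2^2$. $\mathrm{AdS}=\{Q=-1\}\subset E$ with the induced Lorentzian metric. $S(E)$ is the space of rays of $E$; $\mathrm{AdS}$ is identified with its radial projection $\{[x]\in S(E): Q(x)<0\}$, whose boundary in $S(E)$ is $\mathrm{Ein}_2=\{[x]: Q(x)=0\}$. $SO_0(2,2)$ is the identity component of $O(2,2)$, acting on $\mathrm{AdS}$ and $\mathrm{Ein}_2$. Let $\mathbb D^2=\{p=(p_1,p_2,p_3)\in S^2: p_3>0\}$ with closure $\overline{\mathbb D}^2$, and let $d$ be the spherical distance. The map $\overline{\mathbb D}^2\times\mathbb R\to S(E)$, $(p,\theta)\mapsto[(\cos\theta,\sin\theta,p_1,p_2)]$, identifies $\mathbb D^2\times\mathbb R$ with the universal covering $\widetilde{\mathrm{AdS}}$ of $\mathrm{AdS}$ (the metric being conformal to $ds^2-d\theta^2$, $ds^2$ the spherical metric) and $\partial\mathbb D^2\times\mathbb R$ with the infinite cyclic covering $\widehat{\mathrm{Ein}}_2$ of $\mathrm{Ein}_2$.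 Time orientation: $\theta$ increasing. Two points $(x,\theta),(y,\theta')$ of $\overline{\mathbb D}^2\times\mathbb R$ are causally related iff $d(x,y)\le|\theta-\theta'|$. A subset $\widetilde\Lambda$ of $\widehat{\mathrm{Ein}}_2$ is achronal if $d(x,y)\ge|\theta-\theta'|$ for all $(x,\theta),(y,\theta')\in\widetilde\Lambda$; equivalently it is the graph of a $1$-Lipschitz function $f:\Lambda_0\to\mathbb R$, $\Lambda_0\subset\partial\mathbb D^2$. Two points of $\widehat{\mathrm{Ein}}_2$ are opposite if they have the form $(x,\theta)$, $(-x,\theta+\pi)$. The past (future) lightcone of a point is the union of the past-oriented (future-oriented) lightlike geodesic rays $s\mapsto (x(s),\theta_0\mp s)$, $s\ge 0$, starting at it, $x(s)$ being a unit-speed curve on the circle $\partial\mathbb D^2$. $\widetilde\Lambda$ is pure lightlike if it contains two opposite points such that $\widetilde\Lambda$ is contained in the past lightcone of one and the future lightcone of the other; otherwise it is generic. A generic achronal $\widetilde\Lambda$ is nonelementary if there is no point of $\widehat{\mathrm{Ein}}_2$ whose past lightcone contains $\widetilde\Lambda$ and no point whose future lightcone contains $\widetilde\Lambda$. A subset $\Lambda$ of $\mathrm{Ein}_2$ is called (closed, generic, nonelementary) achronal if it is the projection of a (closed, generic, nonelementary) achronal subset $\widetilde\Lambda$ of $\widehat{\mathrm{Ein}}_2$. The invisible domain $E(\Lambda)\subset\mathrm{AdS}$ is the projection of $E(\widetilde\Lambda)=\{(x,\theta)\in\mathbb D^2\times\mathbb R: f_-(x)<\theta<f_+(x)\}$,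 where $f_-(x)=\sup_{y\in\Lambda_0}(f(y)-d(x,y))$ and $f_+(x)=\inf_{y\in\Lambda_0}(f(y)+d(x,y))$ (the set of points not causally related to any point of $\widetilde\Lambda$). *)

(* Defs.v *)
From HB Require Import structures.
From mathcomp Require Import all_boot all_order all_algebra.
From mathcomp Require Import all_classical all_reals all_analysis.

Set Implicit Arguments.
Unset Strict Implicit.
Unset Printing Implicit Defensive.

Import Order.TTheory GRing.Theory Num.Theory.
Import numFieldNormedType.Exports.

Local Open Scope classical_set_scope.
Local Open Scope ring_scope.

Section Linear.
Variable R : realType.

(* Column vectors of E are listed in the order (u, v, x1, x2). *)
Definition vec4 (u v x1 x2 : R) : 'cV[R]_4 :=
  \col_(i < 4) [:: u; v; x1; x2]`_i.

Definition Q (x : 'cV[R]_4) : R :=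
  - x 0 0 ^+ 2 - x 1 0 ^+ 2 + x 2 0 ^+ 2 + x 3 0 ^+ 2.

Definition AdS : set 'cV[R]_4 := [set x | Q x = -1].

(* A point of S(E) is represented by the open half-line it spans in E. *)
Definition ray (x : 'cV[R]_4) : set 'cV[R]_4 :=
  [set t *: x | t in [set t : R | 0 < t]].

Definition Ein2 : set (set 'cV[R]_4) := ray @` [set x | x != 0 /\ Q x = 0].

Definition ray_act (g : 'M[R]_4) (r : set 'cV[R]_4) : set 'cV[R]_4 :=
  (fun x => g *m x) @` r.

Definition O22 : set 'M[R]_4 := [set g | forall x, Q (g *m x) = Q x].

Definition SO022 : set 'M[R]_4 := connected_component O22 1%:M.

Definition is_subgroup (G H : set 'M[R]_4) : Prop :=
  [/\ G `<=` H, G 1%:M, (forall g h, G g -> G h -> G (g *m h))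
    & (forall g, G g -> G (invmx g))].

Definition discrete_subgroup (G H : set 'M[R]_4) : Prop :=
  is_subgroup G H /\ (forall g, G g -> isolated G g).

Definition preserves_rays (G : set 'M[R]_4) (L : set (set 'cV[R]_4)) : Prop :=
  forall g, G g -> ray_act g @` L = L.

(* The first conjunct says that G does act on X. *)
Definition acts_properly_discontinuously (G : set 'M[R]_4)
    (X : set 'cV[R]_4) : Prop :=
  (forall g x, G g -> X x -> X (g *m x)) /\
  (forall K : set 'cV[R]_4, compact K -> K `<=` X ->
    finite_set [set g | G g /\ exists2 x, K x & K (g *m x)]).

End Linear.

Arguments AdS R : clear implicits.
Arguments Ein2 R : clear implicits.
Arguments O22 R : clear implicits.
Arguments SO022 R : clear implicits.

Section Covering.
Variable R : realType.

Definition dot3 (p q : 'rV[R]_3) : R := \sum_(i < 3) p 0 i * q 0 i.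

Definition sphere2 : set 'rV[R]_3 := [set p | dot3 p p = 1].

Definition open_disk : set 'rV[R]_3 := [set p | sphere2 p /\ 0 < p 0 2].

Definition disk_boundary : set 'rV[R]_3 := [set p | sphere2 p /\ p 0 2 = 0].

Definition sdist (p q : 'rV[R]_3) : R := acos (dot3 p q).

Definition AdS_cover : set ('rV[R]_3 * R) := [set a | open_disk a.1].

Definition Ein_cover : set ('rV[R]_3 * R) := [set a | disk_boundary a.1].

Definition proj (a : 'rV[R]_3 * R) : set 'cV[R]_4 :=
  ray (vec4 (cos a.2) (sin a.2) (a.1 0 0) (a.1 0 1)).

Definition achronal (L : set ('rV[R]_3 * R)) : Prop :=
  L `<=` Ein_cover /\
  (forall a b, L a -> L b -> `|a.2 - b.2| <= sdist a.1 b.1).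

Definition opposite (a b : 'rV[R]_3 * R) : Prop :=
  b = (- a.1, a.2 + pi) \/ a = (- b.1, b.2 + pi).

(* The two unit-speed curves on the boundary circle issued from x are
   s |-> rot3 s x and s |-> rot3 (- s) x. *)
Definition rot3 (s : R) (x : 'rV[R]_3) : 'rV[R]_3 :=
  \row_(i < 3) [:: cos s * x 0 0 - sin s * x 0 1;
                   sin s * x 0 0 + cos s * x 0 1;
                   x 0 2]`_i.

Definition past_lightcone (a : 'rV[R]_3 * R) : set ('rV[R]_3 * R) :=
  [set b | exists2 s : R, 0 <= s &
    b = (rot3 s a.1, a.2 - s) \/ b = (rot3 (- s) a.1, a.2 - s)].

Definition future_lightcone (a : 'rV[R]_3 * R) : set ('rV[R]_3 * R) :=
  [set b | exists2 s : R, 0 <= s &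
    b = (rot3 s a.1, a.2 + s) \/ b = (rot3 (- s) a.1, a.2 + s)].

Definition pure_lightlike (L : set ('rV[R]_3 * R)) : Prop :=
  exists a b, [/\ L a, L b, opposite a b,
    L `<=` past_lightcone a & L `<=` future_lightcone b].

Definition generic (L : set ('rV[R]_3 * R)) : Prop := ~ pure_lightlike L.

Definition nonelementary (L : set ('rV[R]_3 * R)) : Prop :=
  (~ exists2 a, Ein_cover a & L `<=` past_lightcone a) /\
  (~ exists2 a, Ein_cover a & L `<=` future_lightcone a).

(* An achronal L is the graph of a function f, so the pairs (y, f y) are the
   elements of L. Extended reals give the usual values when L is empty. *)
Definition f_minus (L : set ('rV[R]_3 * R)) (x : 'rV[R]_3) : \bar R :=
  ereal_sup [set (a.2 - sdist x a.1)%:E | a in L].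

Definition f_plus (L : set ('rV[R]_3 * R)) (x : 'rV[R]_3) : \bar R :=
  ereal_inf [set (a.2 + sdist x a.1)%:E | a in L].

Definition invisible_cover (L : set ('rV[R]_3 * R)) : set ('rV[R]_3 * R) :=
  [set a | [/\ AdS_cover a, (f_minus L a.1 < a.2%:E)%E
             & (a.2%:E < f_plus L a.1)%E]].

(* The hyperboloid AdS is identified with its radial projection to S(E). *)
Definition invisible_domain (L : set ('rV[R]_3 * R)) : set 'cV[R]_4 :=
  [set x | AdS R x /\ (proj @` invisible_cover L) (ray x)].

(* A generic achronal set determines its lift up to theta |-> theta + 2 pi k,
   so the invisible domain does not depend on the lift. *)
Definition cgn_achronal_lift (L : set (set 'cV[R]_4))
    (tL : set ('rV[R]_3 * R)) : Prop :=
  [/\ achronal tL, closed tL, generic tL, nonelementary tL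
    & proj @` tL = L].

End Covering.

Arguments sphere2 R : clear implicits.
Arguments open_disk R : clear implicits.
Arguments disk_boundary R : clear implicits.
Arguments AdS_cover R : clear implicits.
Arguments Ein_cover R : clear implicits.

(* Main.v *)
Require Import Defs.
From mathcomp Require Import all_boot all_order all_algebra.
From mathcomp Require Import all_classical all_reals all_analysis.
From mathcomp Require Import ring lra.
Import Order.TTheory GRing.Theory Num.Theory.
Import numFieldNormedType.Exports.
Local Open Scope classical_set_scope.
Local Open Scope ring_scope.

(* A point x of AdS lies in E(L) iff <x, y> < 0 for every null vector y spanning
   a ray of L; the lift to the universal covering exists because a spherical
   triangle has perimeter at most 2 pi. Hence E(L) is invariant under G.

   Let S be the set of those g in G with gK meeting K, for a compact K in E(L).
   If y spans a ray of L, then so does g y, up to a scalar t; as <x, y> = <gx, gy>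
   with x and gx in K, compactness bounds t, so S y is bounded. If S were
   unbounded, a limit h of normalised elements of S would be nonzero, with Q = 0
   on its image and, S being stable under inversion, with image orthogonal to L.
   So L would lie in the orthogonal of a null vector w, that is, in the union of
   the lightlike geodesics through the points of the covering above w; as the
   lift of L is bounded, it would then lie in the future lightcone of one of
   these points, against nonelementarity. So S is bounded, hence finite, because
   G is discrete. *)

Set Implicit Arguments.
Unset Strict Implicit.
Unset Printing Implicit Defensive.

(** * Convergence and compactness in spaces of matrices *)

Section MatrixTopology.
Variable R : realType.

Lemma cvg_mx (T : Type) (F : set_system T) (FF : Filter F) m n
    (f : T -> 'M[R]_(m, n)) (l : 'M[R]_(m, n)) :
  (forall i j, f x i j @[x --> F] --> l i j) -> f x @[x --> F] --> l.
Proof.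
move=> fl A [P lP PA].
suff : \forall x \near F, forall i j, P i j (f x i j).
  by apply: filterS => x Px; apply: PA.
by apply: filter_forall => i; apply: filter_forall => j; exact: fl (lP i j).
Qed.

Lemma cvg_coord (T : Type) (F : set_system T) (FF : Filter F) m n
    (f : T -> 'M[R]_(m, n)) (l : 'M[R]_(m, n)) i j :
  f x @[x --> F] --> l -> f x i j @[x --> F] --> l i j.
Proof. by move=> fl; exact: (continuous_cvg _ (@coord_continuous R m n i j l)). Qed.

Lemma cvg_mulmx (T : Type) (F : set_system T) (FF : Filter F) m n p
    (f : T -> 'M[R]_(m, n)) (g : T -> 'M[R]_(n, p)) (A : 'M[R]_(m, n))
    (B : 'M[R]_(n, p)) :
  f x @[x --> F] --> A -> g x @[x --> F] --> B ->
  f x *m g x @[x --> F] --> A *m B.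
Proof.
move=> fA gB; apply: cvg_mx => i j; rewrite mxE.
under eq_fun do rewrite mxE.
apply: cvg_big => [|k _]; first exact: add_continuous.
by apply: cvgM; exact: cvg_coord.
Qed.

Lemma cvg_trmx (T : Type) (F : set_system T) (FF : Filter F) m n
    (f : T -> 'M[R]_(m, n)) (A : 'M[R]_(m, n)) :
  f x @[x --> F] --> A -> (f x)^T @[x --> F] --> A^T.
Proof.
move=> fA; apply: cvg_mx => i j; rewrite mxE.
under eq_fun do rewrite mxE.
exact: cvg_coord.
Qed.

(** Flattening by [mxvec] gives a product of segments, compact by Tychonoff; [vec_mx] is
    continuous. *)
Lemma compact_entrywise_bounded m n (M : R) :
  compact [set g : 'M[R]_(m, n) | forall i j, `|g i j| <= M].
Proof.
have cV := @rV_compact R (m * n) (fun=> `[- M, M]%classic)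
  (fun=> @segment_compact R (- M) M).
rewrite (_ : mkset _ = vec_mx @` [set v : 'rV[R]_(m * n) |
    forall i, `[- M, M]%classic (v ord0 i)]); last first.
  apply/seteqP; split=> [g gM|_ [v vM <-] i j] /=.
    exists (mxvec g); last exact: mxvecK.
    by move=> k; case/mxvec_indexP: k => i j; rewrite mxvecE /= in_itv/= -ler_norml.
  by rewrite mxE ler_norml; have := vM (mxvec_index i j); rewrite /= in_itv.
apply: continuous_compact => //; apply: continuous_subspaceT => v.
apply: (@cvg_mx _ (nbhs v)) => i j; rewrite mxE; under eq_fun do rewrite mxE.
exact: coord_continuous.
Qed.

Lemma norm_entry_le m n (g : 'M[R]_(m, n)) i j : `|g i j| <= `|g|.
Proof.
by rewrite [leRHS]/Num.norm /= mx_normrE; apply/bigmax_geP; right; exists (i, j).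
Qed.

Lemma norm_mx_le m n (g : 'M[R]_(m, n)) (M : R) : 0 <= M ->
  (forall i j, `|g i j| <= M) -> `|g| <= M.
Proof.
move=> M0 gM; rewrite [leLHS]/Num.norm /= mx_normrE.
by apply/bigmax_leP; split=> // -[i j] _; exact: gM.
Qed.

(** A cluster point is the limit of a finer proper filter, along which [f] tends both to [f h] and
    to [l]. *)
Lemma cluster_continuous_lim (T : topologicalType) (V : normedModType R)
    (u : nat -> T) (h : T) (f : T -> V) (l : V) :
  cluster (u @ \oo) h -> {for h, continuous f} -> f (u n) @[n --> \oo] --> l ->
  f h = l.
Proof.
rewrite cluster_cvgE /= => -[G GG [Gh uG]] fh ful.
apply: (@cvg_unique _ (@norm_hausdorff R V) (f @ G)).
  by move=> A fA; apply: Gh; exact: fh.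
by move=> A /ful; exact: uG.
Qed.

Lemma bounded_seq_cluster m n (u : nat -> 'M[R]_(m, n)) (M : R) :
  (forall k, `|u k| <= M) -> exists h, cluster (u @ \oo) h.
Proof.
move=> uM; have [|h [_ hu]] := @compact_entrywise_bounded m n M (u @ \oo) _.
  suff : \forall k \near \oo, forall i j, `|u k i j| <= M by [].
  by apply: nearW => k i j; exact: le_trans (norm_entry_le _ _ _) (uM k).
by exists h.
Qed.

End MatrixTopology.

(** * The bilinear form of [Q] and its isometries *)

Section QuadraticForm.
Variable R : realType.
Implicit Types (x y : 'cV[R]_4) (g h : 'M[R]_4).

Definition bil x y : R :=
  - (x 0 0 * y 0 0) - x 1 0 * y 1 0 + x 2 0 * y 2 0 + x 3 0 * y 3 0.

Lemma Q_bil x : Q x = bil x x.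
Proof. by rewrite /Q /bil !expr2. Qed.

Lemma bilC x y : bil x y = bil y x.
Proof. by rewrite /bil; ring. Qed.

Lemma bilZl (t : R) x y : bil (t *: x) y = t * bil x y.
Proof. by rewrite /bil !mxE; ring. Qed.

Lemma bilZr (t : R) x y : bil x (t *: y) = t * bil x y.
Proof. by rewrite bilC bilZl bilC. Qed.

Lemma bil_polar x y : bil x y = (Q (x + y) - Q x - Q y) / 2.
Proof. by rewrite /bil /Q !mxE; field. Qed.

Lemma O22_bil g x y : O22 R g -> bil (g *m x) (g *m y) = bil x y.
Proof. by move=> gO; rewrite !bil_polar -mulmxDr !gO. Qed.

Definition gram : 'M[R]_4 := diag_mx (\row_(i < 4) [:: -1; -1; 1; 1]`_i).

Lemma gram_sqr : gram *m gram = 1%:M.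
Proof.
apply/matrixP=> i j; rewrite mul_diag_mx !mxE.
by case: i j => [[|[|[|[|[]//]]]] ? [[|[|[|[|[]//]]]] ?]]//=; rewrite ?mulr0 ?mulr1 ?mulrNN ?mulr1.
Qed.

Lemma bil_gram g i j : bil (col i g) (col j g) = (g^T *m gram *m g) i j.
Proof.
rewrite mul_mx_diag mxE !big_ord_recl big_ord0 /bil !mxE /=.
rewrite (_ : lift ord0 (lift ord0 (lift ord0 ord0)) = 3); last exact: val_inj.
rewrite (_ : lift ord0 (lift ord0 ord0) = 2); last exact: val_inj.
rewrite (_ : lift ord0 ord0 = 1); last exact: val_inj.
by rewrite !mulr1 !mulrN1 !mulNr addr0 !addrA.
Qed.

(** Invariance of the form reads [g^T *m gram *m g = gram], and [gram] is its own inverse. The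
    inverse of [g] is thus linear in the entries of [g], so inversion is continuous on [O22]. *)
Lemma O22_gram g : O22 R g -> gram *m g^T *m gram *m g = 1%:M.
Proof.
move=> gO; suff : g^T *m gram *m g = gram.
  by move=> e; rewrite -!mulmxA (mulmxA g^T) e gram_sqr.
apply/matrixP=> i j; rewrite -bil_gram !colE O22_bil//.
have := @bil_gram 1%:M i j; rewrite trmx1 mul1mx mulmx1 => <-.
by rewrite !colE !mul1mx.
Qed.

Lemma cvg_bil (T : Type) (F : set_system T) (FF : Filter F)
    (f g : T -> 'cV[R]_4) (a b : 'cV[R]_4) :
  f x @[x --> F] --> a -> g x @[x --> F] --> b ->
  bil (f x) (g x) @[x --> F] --> bil a b.
Proof.
move=> fa gb.
have l i : f x i 0 * g x i 0 @[x --> F] --> a i 0 * b i 0.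
  by apply: cvgM; exact: cvg_coord.
rewrite /bil; apply: cvgD (l 3); apply: cvgD (l 2); apply: cvgB (l 1).
exact: cvgN (l 0).
Qed.

Lemma bil_continuous y : continuous (bil^~ y).
Proof. by move=> x; apply: (@cvg_bil _ (nbhs x)) => //; exact: cvg_cst. Qed.

End QuadraticForm.

(** * Angles modulo 2 pi and the spherical perimeter inequality *)

Section Angles.
Variable R : realType.
Implicit Types (a b c d z : R) (k : int).

Lemma circle_angle a b : a ^+ 2 + b ^+ 2 = 1 ->
  exists t, a = cos t /\ b = sin t.
Proof.
move=> ab1; have a1 : -1 <= a <= 1 by apply/andP; split; nra.
have sa : sin (acos a) = `|b|.
  by rewrite sin_acos// (_ : 1 - a ^+ 2 = b ^+ 2) ?sqrtr_sqr// -ab1; ring.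
have ca : cos (acos a) = a by rewrite acosK// in_itv.
have [b0|b0] := leP 0 b.
  by exists (acos a); rewrite ca sa ger0_norm.
by exists (- acos a); rewrite cosN sinN ca sa ltr0_norm ?opprK.
Qed.

Lemma cos_sinDint z k :
  cos (z + (pi *+ 2) *~ k) = cos z /\ sin (z + (pi *+ 2) *~ k) = sin z.
Proof.
case: k => n /=.
  by rewrite -pmulrn (periodicn (@cosD2pi R)) (periodicn (@sinD2pi R)).
rewrite NegzE mulrNz -pmulrn.
rewrite -(periodicn (@cosD2pi R) n.+1) -(periodicn (@sinD2pi R) n.+1).
by rewrite subrK.
Qed.

(** The floor brings [z] into [[- pi, pi]], where the cosine decreases with the absolute value. *)
Lemma cos_lt_lift z d : 0 <= d <= pi -> cos d < cos z ->
  exists k, `|z + (pi *+ 2) *~ k| < d.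
Proof.
move=> /andP[d0 dpi] dz; have pi0 := pi_gt0 R.
pose k := - Num.floor ((z + pi) / (pi *+ 2)); exists k.
set y := z + _; have yz : cos y = cos z := (cos_sinDint z k).1.
have P0 : 0 < pi *+ 2 :> R by rewrite pmulrn_rgt0.
have ypi : `|y| <= pi.
  have /andP[] := floor_itv ((z + pi) / (pi *+ 2)).
  rewrite ler_pdivlMr// ltr_pdivrMr// => h1 h2.
  rewrite /y /k mulrNz -mulrzr mulrC.
  rewrite intrD mulrDl mul1r in h2.
  by rewrite ler_norml; apply/andP; split; rewrite mulr2n in h1 h2 *; lra.
by rewrite -ltr_cos ?in_itv/= ?d0 ?normr_ge0 ?cos_norm ?yz.
Qed.

Lemma cos_lt_acos z c : -1 <= c <= 1 -> `|z| < acos c -> c < cos z.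
Proof.
move=> c1 zc; have cpi := acos_lepi c1.
rewrite -cos_norm -[c]acosK ?in_itv//= ltr_cos ?in_itv/= ?normr_ge0 ?acos_ge0//=.
exact: le_trans (ltW zc) cpi.
Qed.

(* Spherical triangles have perimeter at most 2 pi; the first hypothesis says
   that the Gram determinant of three unit vectors is nonnegative. *)
Lemma acos_perimeter a b c :
  0 <= 1 - a ^+ 2 - b ^+ 2 - c ^+ 2 + 2 * a * b * c ->
  -1 <= a <= 1 -> -1 <= b <= 1 -> -1 <= c <= 1 ->
  acos a + acos b + acos c <= pi *+ 2.
Proof.
move=> gram_ge0 a1 b1 c1; have pi0 := pi_gt0 R.
have := acos_lepi a1; have := acos_lepi b1; have := acos_lepi c1.
have := acos_ge0 a1; have := acos_ge0 b1; have := acos_ge0 c1.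
set A := acos a; set B := acos b; set C := acos c => C0 B0 A0 Cpi Bpi Api.
(* If [A + B <= pi], then [C <= pi] suffices. Otherwise [A + B - pi] and [pi - C] lie in [[0, pi]]
   and are compared through their cosines. *)
have [ABpi|ABpi] := leP (A + B) pi; first by rewrite mulr2n; lra.
have sab : cos (A + B - pi) = sin A * sin B - a * b.
  rewrite cosB cospi sinpi cosD /A /B !acosK ?in_itv//=; ring.
have cC : cos (pi - C) = - c by rewrite cosB cospi sinpi /C acosK ?in_itv//=; ring.
suff : A + B - pi <= pi - C by rewrite mulr2n; lra.
rewrite leNgt -ltr_cos ?in_itv/=; last 2 first.
- by apply/andP; split; lra.
- by apply/andP; split; lra.
rewrite -leNgt cC sab.
have sA2 : sin A ^+ 2 = 1 - a ^+ 2 by rewrite sin2cos2 /A acosK ?in_itv.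
have sB2 : sin B ^+ 2 = 1 - b ^+ 2 by rewrite sin2cos2 /B acosK ?in_itv.
have sA0 : 0 <= sin A by apply: sin_ge0_pi; rewrite A0 Api.
have sB0 : 0 <= sin B by apply: sin_ge0_pi; rewrite B0 Bpi.
(* Squared, this is the Gram hypothesis: [(1 - a^2) (1 - b^2) - (a b - c)^2] is the Gram
   determinant. *)
suff : `|a * b - c| <= sin A * sin B by rewrite ler_norml => /andP[]; lra.
rewrite -(@ler_pXn2r _ 2) ?nnegrE ?mulr_ge0// real_normK ?num_real//.
by rewrite exprMn sA2 sB2; lra.
Qed.

End Angles.

(** * Scalar products and distances of unit vectors *)

Section UnitVectors.
Variable R : realType.
Implicit Types (p q r : 'rV[R]_3) (a b : 'rV[R]_3 * R).

Lemma dot3E p q :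
  dot3 p q = p 0 0 * q 0 0 + p 0 1 * q 0 1 + p 0 2 * q 0 2.
Proof.
rewrite /dot3 !big_ord_recl big_ord0 addr0 !addrA.
rewrite (_ : lift ord0 (lift ord0 ord0) = 2); last exact: val_inj.
by rewrite (_ : lift ord0 ord0 = 1); last exact: val_inj.
Qed.

Lemma dot3_bound p q : sphere2 R p -> sphere2 R q -> -1 <= dot3 p q <= 1.
Proof.
rewrite /sphere2 /= !dot3E => p1 q1.
have := sqr_ge0 (p 0 0 - q 0 0); have := sqr_ge0 (p 0 1 - q 0 1).
have := sqr_ge0 (p 0 2 - q 0 2); have := sqr_ge0 (p 0 0 + q 0 0).
have := sqr_ge0 (p 0 1 + q 0 1); have := sqr_ge0 (p 0 2 + q 0 2).
by move=> *; apply/andP; split; nra.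
Qed.

(** A point of the open hemisphere is neither equal nor antipodal to a boundary point; strictness
    serves the continuity of [acos]. *)
Lemma dot3_lt1 p q : open_disk R p -> disk_boundary R q -> -1 < dot3 p q < 1.
Proof.
rewrite /open_disk /disk_boundary /sphere2 /= !dot3E => -[p1 p0] [q1 q0].
rewrite q0 in q1 *.
have := sqr_ge0 (p 0 0 - q 0 0); have := sqr_ge0 (p 0 1 - q 0 1).
have := sqr_ge0 (p 0 0 + q 0 0); have := sqr_ge0 (p 0 1 + q 0 1).
have : 0 < p 0 2 * p 0 2 by rewrite mulr_gt0.
by move=> *; apply/andP; split; nra.
Qed.

Lemma sdist_perimeter p q r : sphere2 R p -> sphere2 R q -> sphere2 R r ->
  sdist p q + sdist p r + sdist q r <= pi *+ 2.
Proof.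
move=> p1 q1 r1; apply: acos_perimeter; rewrite ?dot3_bound//.
(* The Gram determinant of three vectors is the square of their determinant. *)
have /= : 0 <= (p 0 0 * (q 0 1 * r 0 2 - q 0 2 * r 0 1)
              - p 0 1 * (q 0 0 * r 0 2 - q 0 2 * r 0 0)
              + p 0 2 * (q 0 0 * r 0 1 - q 0 1 * r 0 0)) ^+ 2 by exact: sqr_ge0.
set D2 := (X in 0 <= X); suff -> : D2 = dot3 p p * dot3 q q * dot3 r r
    - dot3 p q ^+ 2 * dot3 r r - dot3 p r ^+ 2 * dot3 q q
    - dot3 q r ^+ 2 * dot3 p p + 2 * dot3 p q * dot3 p r * dot3 q r.
  by rewrite p1 q1 r1 !mulr1.
by rewrite /D2 !dot3E; ring.
Qed.

End UnitVectors.

(** * Null vectors and lightcones in the covering *)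

Section Cover.
Variable R : realType.
Implicit Types (p q r : 'rV[R]_3) (a b : 'rV[R]_3 * R) (tL : set ('rV[R]_3 * R)).

Definition cover_vec a : 'cV[R]_4 :=
  vec4 (cos a.2) (sin a.2) (a.1 0 0) (a.1 0 1).

(** For unit vectors, the sign of the form thus compares the cosine of [sdist a.1 b.1] with that of
    the angle difference. *)
Lemma bil_cover_vec a b : b.1 0 2 = 0 ->
  bil (cover_vec a) (cover_vec b) = dot3 a.1 b.1 - cos (a.2 - b.2).
Proof.
by move=> b0; rewrite /bil !mxE /= dot3E b0 cosB; ring.
Qed.

Lemma sqr_sum_eq0 (x y : R) : x ^+ 2 + y ^+ 2 = 0 -> x = 0 /\ y = 0.
Proof.
by move=> /eqP; rewrite paddr_eq0 ?sqr_ge0// !sqrf_eq0 => /andP[/eqP ? /eqP].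
Qed.

(** Up to scale, [w] is the vector of a boundary point [(q, t)]. Orthogonality makes each [a.1] a
    rotation of [q] by plus or minus the angle difference. *)
Lemma null_orthogonal_cone tL (w : 'cV[R]_4) (c : R) :
  tL `<=` Ein_cover R -> (forall a, tL a -> c <= a.2) ->
  w != 0 -> Q w = 0 -> (forall a, tL a -> bil w (cover_vec a) = 0) ->
  exists2 a, Ein_cover R a & tL `<=` future_lightcone a.
Proof.
move=> tLE tLc w0 Qw wtL.
pose n := w 0 0 ^+ 2 + w 1 0 ^+ 2.
have Qw' : w 2 0 ^+ 2 + w 3 0 ^+ 2 = n.
  by move: Qw; rewrite /Q /n => Qw; lra.
have n0 : 0 < n.
  rewrite lt_def addr_ge0 ?sqr_ge0// andbT; apply: contra_neq w0 => n0.
  have [w00 w10] := sqr_sum_eq0 n0.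
  have [w20 w30] := sqr_sum_eq0 (etrans Qw' n0).
  apply/matrixP => i j; rewrite ord1 mxE.
  case: i => [[|[|[|[|[]//]]]] i4]; [rewrite -[RHS]w00|rewrite -[RHS]w10|
    rewrite -[RHS]w20|rewrite -[RHS]w30]; congr (w _ _); exact: val_inj.
pose r := Num.sqrt n; have r0 : 0 < r by rewrite sqrtr_gt0.
have r2 : r ^+ 2 = n by rewrite sqr_sqrtr// ltW.
have [|t [w0t w1t]] := @circle_angle R (w 0 0 / r) (w 1 0 / r).
  by rewrite !expr_div_n -mulrDl r2 divff// gt_eqF.
pose q : 'rV[R]_3 := \row_(i < 3) [:: w 2 0 / r; w 3 0 / r; 0]`_i.
have q1 : q 0 0 ^+ 2 + q 0 1 ^+ 2 = 1.
  by rewrite !mxE /= !expr_div_n -mulrDl r2 Qw' divff// gt_eqF.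
have qE : disk_boundary R q.
  by rewrite /disk_boundary /sphere2 /= dot3E -!expr2 [q 0 2]mxE /= expr0n /= addr0.
have wE : w = r *: cover_vec (q, t).
  apply/matrixP => i j; rewrite ord1 !mxE /=.
  by case: i => [[|[|[|[|[]//]]]] i4] /=; rewrite -?w0t -?w1t ?mxE /= mulrC divfK ?gt_eqF//;
   congr (w _ _); exact: val_inj.
(* Enough full turns to lower the apex below [c], so that every difference [s] is nonnegative. *)
pose k := Num.bound (`|c - t| / (pi *+ 2)).
have P0 : 0 < pi *+ 2 :> R by rewrite pmulrn_rgt0// pi_gt0.
have kP : t - (pi *+ 2) *+ k <= c.
  have := @archi_boundP R (`|c - t| / (pi *+ 2)).
  rewrite divr_ge0 ?(ltW P0)// => /(_ isT); rewrite ltr_pdivrMr// -/k mulrC mulr_natr.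
  have := ler_norm (t - c); rewrite distrC; lra.
exists (q, t - (pi *+ 2) *+ k); first by [].
move=> a aL; exists (a.2 - (t - (pi *+ 2) *+ k)); first by rewrite subr_ge0 (le_trans kP)// tLc.
have [a1 a0] := tLE _ aL; rewrite /sphere2/= dot3E a0 in a1.
have /eqP := wtL _ aL; rewrite wE bilZl mulf_eq0 gt_eqF//= bil_cover_vec//=.
rewrite subr_eq0 dot3E a0 => /eqP dqa.
set s := a.2 - _.
have -> : a = (a.1, (t - (pi *+ 2) *+ k) + s) by rewrite /s addrC subrK; case: (a).
have cs : cos s = cos (t - a.2).
  rewrite /s opprB addrA addrAC.
  by rewrite (periodicn (@cosD2pi R)) -cosN opprB.
have ss : sin s = - sin (t - a.2).
  rewrite /s opprB addrA addrAC.
  by rewrite (periodicn (@sinD2pi R)) -sinN opprB.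
rewrite -cs in dqa.
(* In the frame of [q] and its quarter turn, [a.1] has coordinates [cos s] and [v]; so [v] is
   [sin s] up to sign, one sign for each branch of the cone. *)
pose v := q 0 0 * a.1 0 1 - q 0 1 * a.1 0 0.
have v2 : v ^+ 2 = sin s ^+ 2.
  rewrite sin2cos2 -dqa mulr0 addr0 -[1]mulr1 -{1}q1 -a1 /v; ring.
have a10 : a.1 0 0 = cos s * q 0 0 - v * q 0 1.
  by rewrite -[LHS]mul1r -q1 -dqa /v; ring.
have a11 : a.1 0 1 = v * q 0 0 + cos s * q 0 1.
  by rewrite -[LHS]mul1r -q1 -dqa /v; ring.
have rowE (f : 'rV[R]_3) : f 0 0 = a.1 0 0 -> f 0 1 = a.1 0 1 ->
    f 0 2 = a.1 0 2 -> a.1 = f.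
  move=> f0 f1 f2; apply/matrixP => i j; rewrite ord1.
  case: j => [[|[|[|//]]] j3]; [move: f0|move: f1|move: f2] => fj.
  - by rewrite (_ : Ordinal j3 = 0) ?fj//; exact: val_inj.
  - by rewrite (_ : Ordinal j3 = 1) ?fj//; exact: val_inj.
  - by rewrite (_ : Ordinal j3 = 2) ?fj//; exact: val_inj.
have /orP[/eqP vs|/eqP vs] : (v == sin s) || (v == - sin s) by rewrite -eqf_sqr v2.
  left; congr (_, _); apply: rowE; rewrite mxE /= ?a10 ?a11 ?a0 ?vs//.
  by rewrite mxE.
right; congr (_, _); apply: rowE; rewrite mxE /= ?a10 ?a11 ?a0 ?vs ?cosN ?sinN//.
by rewrite mxE.
Qed.

End Cover.

(** * The invisible domain described by linear inequalities *)

Section InvisibleDomain.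
Variable R : realType.
Implicit Types (p q r : 'rV[R]_3) (a b : 'rV[R]_3 * R) (tL : set ('rV[R]_3 * R)).

Lemma sphere2_entry p i : sphere2 R p -> `|p 0 i| <= 1.
Proof.
rewrite /sphere2 /= dot3E => p1; rewrite -(@ler_pXn2r _ 2) ?nnegrE//.
rewrite real_normK ?num_real// expr1n.
have s0 := sqr_ge0 (p 0 0); have s1 := sqr_ge0 (p 0 1).
have s2 := sqr_ge0 (p 0 2); rewrite -!expr2 in p1.
case: i => [[|[|[|//]]] i3].
- by rewrite (_ : Ordinal i3 = 0); [lra|exact: val_inj].
- by rewrite (_ : Ordinal i3 = 1); [lra|exact: val_inj].
- by rewrite (_ : Ordinal i3 = 2); [lra|exact: val_inj].
Qed.

(** Spherical distances are at most pi, so all angles of [tL] lie within pi of any one of them. *)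
Lemma achronal_compact tL : achronal tL -> closed tL -> compact tL.
Proof.
move=> [tLE tLa] tLc; have [->|/set0P[b bL]] := eqVneq tL set0; first exact: compact0.
have cV := @rV_compact R 3 (fun=> `[-1, 1]%classic)
  (fun=> @segment_compact R (-1) 1).
have cI := @segment_compact R (b.2 - pi) (b.2 + pi).
apply: subclosed_compact tLc (compact_setX cV cI) _ => a aL; split=> /=.
  by move=> i; rewrite /= in_itv /= -ler_norml sphere2_entry//; case: (tLE _ aL).
have [a1 _] := tLE _ aL; have [b1 _] := tLE _ bL.
have := le_trans (tLa _ _ aL bL) (acos_lepi (dot3_bound a1 b1)).
by rewrite in_itv /= ler_distl.
Qed.

Lemma cover_vec_continuous : continuous (@cover_vec R).
Proof.
move=> a; apply: (@cvg_mx _ _ (nbhs a)) => i j; rewrite mxE.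
under eq_fun do rewrite mxE.
have c1 k : (fun b : 'rV[R]_3 * R => b.1 0 k) @ nbhs a --> a.1 0 k.
  by apply: cvg_coord; exact: cvg_fst.
have c2 : (fun b : 'rV[R]_3 * R => b.2) @ nbhs a --> a.2 by exact: cvg_snd.
case: i => [[|[|[|[|[]//]]]] i4] /=; [| | exact: c1 | exact: c1].
- exact: continuous_cvg (@continuous_cos R a.2) c2.
- exact: continuous_cvg (@continuous_sin R a.2) c2.
Qed.

Lemma sdist_continuous p a : open_disk R p -> disk_boundary R a.1 ->
  {for a, continuous (fun b => sdist p b.1)}.
Proof.
move=> pD aE; apply: (@continuous_comp _ _ _ (fun b => dot3 p b.1) (@acos R)); last first.
  exact: (continuous_acos (dot3_lt1 pD aE)).
have ci i : (fun b : 'rV[R]_3 * R => p 0 i * b.1 0 i) @ nbhs a -->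
    p 0 i * a.1 0 i.
  by apply: cvgM; [exact: cvg_cst|apply: cvg_coord; exact: cvg_fst].
by apply: cvg_big => [|i _]; [exact: add_continuous|exact: ci].
Qed.

Lemma ray_scale (t : R) (x : 'cV[R]_4) : 0 < t -> ray (t *: x) = ray x.
Proof.
move=> t0; apply/seteqP; split=> _ [s /= s0 <-].
  by exists (s * t); rewrite ?scalerA//= mulr_gt0.
by exists (s / t); rewrite /= ?divr_gt0// scalerA divfK// gt_eqF.
Qed.

Lemma mem_ray (x : 'cV[R]_4) : ray x x.
Proof. by exists 1; rewrite /= ?scale1r. Qed.

(** The scale [r] is the Euclidean length of the [(u, v)] part; [Q x = -1] makes [1 / r] the third
    coordinate of a unit vector. *)
Lemma AdS_cover_vec (x : 'cV[R]_4) : AdS R x ->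
  exists a (r : R), [/\ AdS_cover R a, 0 < r & x = r *: cover_vec a].
Proof.
rewrite /AdS /Q /= => Qx; pose n := x 0 0 ^+ 2 + x 1 0 ^+ 2.
have nE : n = 1 + (x 2 0 ^+ 2 + x 3 0 ^+ 2) by rewrite /n; lra.
have n0 : 0 < n by rewrite nE ltr_wpDr// addr_ge0 ?sqr_ge0.
pose r := Num.sqrt n; have r0 : 0 < r by rewrite sqrtr_gt0.
have r2 : r ^+ 2 = n by rewrite sqr_sqrtr// ltW.
have [|t [x0t x1t]] := @circle_angle R (x 0 0 / r) (x 1 0 / r).
  by rewrite !expr_div_n -mulrDl r2 divff// gt_eqF.
pose p : 'rV[R]_3 := \row_(i < 3) [:: x 2 0 / r; x 3 0 / r; 1 / r]`_i.
exists (p, t), r; split=> //.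
  rewrite /AdS_cover /open_disk /sphere2 /= dot3E !mxE /= divr_gt0//; split=> //.
  rewrite -!expr2 !expr_div_n -!mulrDl r2 expr1n addrC -nE divff// gt_eqF//.
apply/matrixP => i j; rewrite ord1 !mxE /=.
by case: i => [[|[|[|[|[]//]]]] i4] /=; rewrite -?x0t -?x1t ?mxE /= mulrC divfK ?gt_eqF//;
   congr (x _ _); exact: val_inj.
Qed.

Lemma invisible_domainP tL (x : 'cV[R]_4) :
  achronal tL -> compact tL -> tL !=set0 ->
  invisible_domain tL x <->
    AdS R x /\ forall b, tL b -> bil x (cover_vec b) < 0.
Proof.
move=> [tLE tLa] tLc [b0 b0L]; split.
  move=> [xA [a [aA aminus aplus] ax]]; split=> // b bL.
  have : ray x x := mem_ray x.
  rewrite -ax => -[s /= s0 <-]; have [bS b0'] := tLE _ bL.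
  rewrite -/(cover_vec a) bilZl pmulr_rlt0// bil_cover_vec// subr_lt0.
  have aS : sphere2 R a.1 by case: aA.
  apply: cos_lt_acos; first exact: dot3_bound.
  have ha : a.2 < b.2 + sdist a.1 b.1.
    by rewrite -lte_fin; apply: (lt_le_trans aplus); apply: ereal_inf_lbound; exists b.
  have hb : b.2 - sdist a.1 b.1 < a.2.
    by rewrite -lte_fin; apply: le_lt_trans aminus; apply: ereal_sup_ubound; exists b.
  by rewrite -/(sdist a.1 b.1) ltr_norml; apply/andP; split; lra.
move=> [xA xneg]; split=> //.
have [[p t] [r [pD r0 xE]]] := AdS_cover_vec xA.
have pS : sphere2 R p by case: pD.
have lift b : tL b -> exists k : int, `|t - b.2 + (pi *+ 2) *~ k| < sdist p b.1.
  move=> bL; have [bS b0'] := tLE _ bL; have pb := dot3_bound pS bS.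
  apply: cos_lt_lift; first by rewrite acos_ge0// acos_lepi.
  rewrite acosK ?in_itv//= -subr_lt0 -(@bil_cover_vec _ (p, t))//.
  by rewrite -(@pmulr_rlt0 _ r)// -bilZl -xE xneg.
(* The lift is chosen for [b0] and then shown to serve every [b]. *)
have [k0 k0P] := lift _ b0L; pose s := t + (pi *+ 2) *~ k0.
have sP b : tL b -> `|s - b.2| < sdist p b.1.
  move=> bL; have [k kP] := lift _ bL.
  have [bS _] := tLE _ bL; have [b0S _] := tLE _ b0L.
  have := sdist_perimeter pS bS b0S; have := tLa _ _ bL b0L.
  move=> d1 d2; rewrite /s addrAC; suff -> : k0 = k by [].
  have P0 : 0 < pi *+ 2 :> R by rewrite pmulrn_rgt0// pi_gt0.
  (* The lifts for [b] and [b0] differ by less than the perimeter of the triangle [p], [b.1],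
     [b0.1], hence by less than one turn. *)
  have : `|(pi *+ 2) *~ (k - k0)| < pi *+ 2 :> R.
    rewrite mulrzBr; move: kP k0P d1; set X := _ *~ k; set Y := _ *~ k0.
    rewrite !ltr_norml ler_norml => /andP[? ?] /andP[? ?] /andP[? ?].
    by apply/andP; split; lra.
  rewrite -mulrzr normrM (gtr0_norm P0) -ltr_pdivlMl// mulVf ?gt_eqF//.
  rewrite -intr_norm -[1]/(1%:~R) ltr_int.
  move: (k - k0) (subr0_eq (x := k) (y := k0)); case=> [[|n]|n] //= kk _.
  by rewrite kk.
exists (p, s); last first.
  have [cs ss] := cos_sinDint t k0.
  by rewrite xE ray_scale// /Defs.proj /cover_vec /= /s cs ss.
have cdist b : tL b -> {for b, continuous (fun b => sdist p b.1)}.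
  by move=> bL; apply: sdist_continuous => //; exact: tLE.
have cang (b : 'rV[R]_3 * R) : {for b, continuous (fun b => b.2)}.
  exact: cvg_snd.
have tL0 : tL !=set0 by exists b0.
(* By compactness of [tL] the supremum and the infimum are attained, so the inequalities stay
   strict. *)
split=> //=.
- have [|b /set_mem bL bmax] := @compact_EVT_max _ R (fun b => b.2 - sdist p b.1) _ tL0 tLc.
    apply: continuous_in_subspaceT => b /set_mem bL.
    by apply: continuousB; [exact: cang|exact: cdist].
  apply: (@le_lt_trans _ _ (b.2 - sdist p b.1)%:E).
    by apply: ge_ereal_sup => _ [c cL <-]; rewrite lee_fin; apply: bmax; exact: mem_set.
  by rewrite lte_fin; have := sP _ bL; rewrite ltr_norml => /andP[]; lra.
- have [|b /set_mem bL bmin] := @compact_EVT_min _ R (fun b => b.2 + sdist p b.1) _ tL0 tLc.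
    apply: continuous_in_subspaceT => b /set_mem bL.
    by apply: continuousD; [exact: cang|exact: cdist].
  apply: (@lt_le_trans _ _ (b.2 + sdist p b.1)%:E).
    by rewrite lte_fin; have := sP _ bL; rewrite ltr_norml => /andP[]; lra.
  by apply: le_ereal_inf_tmp => _ [c cL <-]; rewrite lee_fin; apply: bmin; exact: mem_set.
Qed.


End InvisibleDomain.

(** * Bounded and unbounded families of isometries *)

Section Dynamics.
Variable R : realType.
Implicit Types (G S : set 'M[R]_4) (K : set 'cV[R]_4) (x y : 'cV[R]_4).
Implicit Types (tL : set ('rV[R]_3 * R)).

Lemma O22_unitmx (g : 'M[R]_4) : O22 R g -> g \in unitmx.
Proof. by move=> /O22_gram gE; have [] := mulmx1_unit gE. Qed.

(** An infinite bounded [S] has an injective sequence clustering at some [h]. Quotients of terms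
    near [h] approach the identity, which is isolated in [G], so two distinct terms would
    coincide. *)
Lemma discrete_bounded_finite G S (M : R) :
  discrete_subgroup G (O22 R) -> S `<=` G -> (forall g, S g -> `|g| <= M) ->
  finite_set S.
Proof.
move=> [[GO G1 GM GV] Giso] SG SM; apply: contrapT => /infiniteP/ppcard_leP[u].
have uS n : S (u n) by exact: funS.
have [h hu] := bounded_seq_cluster (fun n => SM _ (uS n)).
have hO : O22 R h.
  move=> x; rewrite Q_bil.
  apply: (@cluster_continuous_lim R _ _ u h (fun g => bil (g *m x) (g *m x))) => //.
    apply: (@cvg_bil _ _ (nbhs h)); apply: (@cvg_mulmx _ _ (nbhs h)) => //; exact: cvg_cst.
  under eq_fun do rewrite -Q_bil (GO _ (SG _ (uS _))).
  exact: cvg_cst.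
have [_ [V V1 VG]] := Giso _ G1.
(* On [O22] this is the inverse of [z.1] times [z.2], in a visibly continuous form. *)
pose phi (z : 'M[R]_4 * 'M[R]_4) := (gram R *m z.1^T *m gram R) *m z.2.
have phic : phi @ nbhs (h, h) --> (1%:M : 'M[R]_4).
  rewrite -(O22_gram hO); apply: cvg_mulmx; last exact: cvg_snd.
  apply: cvg_mulmx; last exact: cvg_cst.
  apply: cvg_mulmx; first exact: cvg_cst.
  by apply: cvg_trmx; exact: cvg_fst.
have [[A B] /= [hA hB] AB] := phic _ V1.
have hAB : nbhs h (A `&` B) by exact: filterI.
have uT : (u @ \oo) [set g | exists n, g = u n] by exists 0%N => // n _; exists n.
have [_ [[n ->] [nA _]]] := hu _ _ uT hAB.
have uN : (u @ \oo) [set g | exists2 m, (n < m)%N & g = u m].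
  by exists n.+1 => // m /= nm; exists m.
have [_ [[m nm ->] [_ mB]]] := hu _ _ uN hAB.
have unO := GO _ (SG _ (uS n)).
have phiE : phi (u n, u m) = invmx (u n) *m u m.
  rewrite /phi /=; congr (_ *m _).
  by rewrite -[LHS]mulmx1 -(mulmxV (O22_unitmx unO)) mulmxA O22_gram// mul1mx.
have : (V `&` G) (phi (u n, u m)).
  by split; [exact: (AB (u n, u m))|rewrite phiE; apply: GM; [apply: GV|]; exact: SG].
rewrite VG phiE /= => unm.
have /(congr1 (mulmx (u n))) := unm.
rewrite mulmxA mulmxV ?O22_unitmx// mul1mx mulmx1.
by move=> /inj; rewrite !inE => /(_ I I) mn; rewrite mn ltnn in nm.
Qed.

Lemma bil_le x y : `|bil x y| <= 4 * `|x| * `|y|.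
Proof.
have e i : `|x i 0 * y i 0| <= `|x| * `|y|.
  by rewrite normrM ler_pM// norm_entry_le.
move: (e 0) (e 1) (e 2) (e 3); rewrite /bil -mulrA; set z := `|x| * `|y|.
by rewrite !ler_norml => /andP[? ?] /andP[? ?] /andP[? ?] /andP[? ?]; apply/andP; split; lra.
Qed.

(** Pairing [g x] with [y] amounts to pairing [x] with the image of [y] under the inverse of [g],
    which again spans a ray of [L]. *)
Lemma invisible_domain_stable tL G (L : set (set 'cV[R]_4)) g x :
  achronal tL -> compact tL -> tL !=set0 -> @Defs.proj R @` tL = L ->
  is_subgroup G (O22 R) -> preserves_rays G L ->
  G g -> invisible_domain tL x -> invisible_domain tL (g *m x).
Proof.
move=> tLa tLc tL0 tLL [GO G1 GM GV] GL Gg.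
rewrite !invisible_domainP// => -[xA xneg]; split.
  by rewrite /AdS /= GO.
move=> b bL; have gU := O22_unitmx (GO _ Gg).
rewrite -(O22_bil _ _ (GO _ (GV _ Gg))) mulKmx//.
have : L (ray_act (invmx g) (Defs.proj b)).
  by rewrite -(GL _ (GV _ Gg)); exists (Defs.proj b) => //; rewrite -tLL; exists b.
rewrite -tLL => -[c cL cE].
have : ray_act (invmx g) (Defs.proj b) (invmx g *m cover_vec b).
  by exists (cover_vec b) => //; exact: mem_ray.
by rewrite -cE => -[t /= t0 <-]; rewrite bilZr pmulr_rlt0// xneg.
Qed.

Lemma returning_orbit_bounded tL G (L : set (set 'cV[R]_4)) K b :
  achronal tL -> compact tL -> @Defs.proj R @` tL = L ->
  is_subgroup G (O22 R) -> preserves_rays G L ->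
  compact K -> K `<=` invisible_domain tL -> tL b ->
  exists C, forall g, G g -> (exists2 x, K x & K (g *m x)) ->
    `|g *m cover_vec b| <= C.
Proof.
move=> tLa tLc tLL [GO _ _ _] GL Kc Kinv bL.
have [K0|/set0P K0] := eqVneq K set0.
  by exists 0 => g _ [x]; rewrite K0.
have tL0 : tL !=set0 by exists b.
have [|xM _ xMP] := @compact_EVT_max _ R (fun x => `|bil x (cover_vec b)|) K K0 Kc.
  apply: continuous_subspaceT => x; apply: (@cvg_norm _ _ _ (nbhs x)).
  exact: bil_continuous.
pose f (z : 'cV[R]_4 * ('rV[R]_3 * R)) := bil z.1 (cover_vec z.2).
have [|||[xm bm] /set_mem[/= xmK bmL] mP] := @compact_EVT_max _ R f (K `*` tL).
- by case: K0 => x Kx; exists (x, b).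
- exact: compact_setX.
- apply: continuous_subspaceT => z; apply: (@cvg_bil _ _ (nbhs z)).
    exact: cvg_fst.
  by apply: continuous_comp; [exact: cvg_snd|exact: cover_vec_continuous].
(* The largest value of the form on [K] and [tL]; being attained, it is negative. *)
set m := f (xm, bm) in mP.
have m0 : m < 0.
  by have /invisible_domainP[]// := Kinv _ xmK => _; exact.
(* If [g y = t c] with [y = cover_vec b] and [c] a cover vector, of norm at most 1, then
   [t * bil (g x) c = bil x y], whence [t * - m] is at most the numerator. *)
exists (`|bil xM (cover_vec b)| / - m) => g Gg [x Kx Kgx].
have : L (ray_act g (Defs.proj b)).
  by rewrite -(GL _ Gg); exists (Defs.proj b) => //; rewrite -tLL; exists b.
rewrite -tLL => -[c cL cE].
have : ray_act g (Defs.proj b) (g *m cover_vec b).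
  by exists (cover_vec b) => //; exact: mem_ray.
rewrite -cE => -[t /= t0]; rewrite -/(cover_vec c) => tE.
have c1 : `|cover_vec c| <= 1.
  have [tLE _] := tLa; have [cS _] := tLE _ cL.
  apply: norm_mx_le => // i j; rewrite mxE.
  case: i => [[|[|[|[|[]//]]]] i4] /=; rewrite ?cos_max ?sin_max ?sphere2_entry//.
rewrite -tE normrZ gtr0_norm// ler_pdivlMr ?oppr_gt0//.
apply: (@le_trans _ _ (t * - m)).
  by rewrite ler_wpM2r ?oppr_ge0 ?(ltW m0)// ler_piMr// ltW.
apply: (@le_trans _ _ (- (t * bil (g *m x) (cover_vec c)))).
  rewrite mulrN lerN2 ler_pM2l//; apply: (mP (g *m x, c)); exact: mem_set.
rewrite -bilZr tE O22_bil; last exact: GO.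
by rewrite (le_trans (ler_norm _))// normrN; apply: xMP; exact: mem_set.
Qed.

Lemma cvg0_harmonic_bound (f : nat -> R) (C : R) :
  (forall n, `|f n| <= C / n.+1%:R) -> f n @[n --> \oo] --> (0 : R).
Proof.
move=> fC; apply: norm_cvg0; apply: (@squeeze_cvgr _ _ _ _ (cst 0)
    (fun n => C * n.+1%:R^-1)).
- by apply: nearW => n; rewrite normr_ge0 fC.
- exact: cvg_cst.
- by rewrite -(mulr0 C); apply: cvgM; [exact: cvg_cst|exact: cvg_harmonic].
Qed.

(* The limit [h] of the normalised elements is the point: its image is totally
   isotropic because the elements are isometries of [Q] whose norm diverges, and
   it is orthogonal to [Y] because the orbits of the inverses stay bounded. *)
Lemma unbounded_isotropic S (Y : set 'cV[R]_4) :
  S `<=` O22 R -> (forall g, S g -> S (invmx g)) ->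
  (forall y, Y y -> exists C, forall g, S g -> `|g *m y| <= C) ->
  ~ (exists M, forall g, S g -> `|g| <= M) ->
  exists w, [/\ w != 0, Q w = 0 & forall y, Y y -> bil w y = 0].
Proof.
move=> SO SV SY Sunb.
(* Using [n.+1] keeps the norms at least 1 and their inverses below the harmonic sequence. *)
have /choice[u uP] n : exists g, S g /\ n.+1%:R < `|g|.
  apply: contrapT => nog; apply: Sunb; exists n.+1%:R => g Sg.
  by rewrite leNgt; apply/negP => ng; apply: nog; exists g.
have uS n : S (u n) := (uP n).1.
have uO n : O22 R (u n) := SO _ (uS n).
have u_gt n : n.+1%:R < `|u n| := (uP n).2.
have u0 n : 0 < `|u n| by exact: lt_trans (u_gt n).
have u1 n : 1 <= `|u n| by apply: le_trans (ltW (u_gt n)); rewrite ler1n.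
have uV n : `|u n|^-1 <= n.+1%:R^-1 by rewrite lef_pV2 ?posrE// ltW.
pose v n := `|u n|^-1 *: u n.
have v1 n : `|v n| = 1.
  by rewrite normrZ ger0_norm ?invr_ge0// mulVf// gt_eqF.
have [|h hv] := @bounded_seq_cluster R _ _ v 1; first by move=> n; rewrite v1.
have h1 : `|h| = 1.
  apply: (@cluster_continuous_lim R _ _ v h (fun g => `|g|)) => //.
    exact: norm_continuous.
  by under eq_fun do rewrite v1; exact: cvg_cst.
have hcont x : {for h, continuous (fun g : 'M[R]_4 => g *m x)}.
  by apply: (@cvg_mulmx _ _ (nbhs h)) => //; exact: cvg_cst.
have hQ x : Q (h *m x) = 0.
  rewrite Q_bil.
  apply: (@cluster_continuous_lim R _ _ v h (fun g => bil (g *m x) (g *m x))) => //.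
    by apply: (@cvg_bil _ _ (nbhs h)); exact: hcont.
  apply: (@cvg0_harmonic_bound _ `|Q x|) => n.
  rewrite -scalemxAl bilZl bilZr O22_bil// -Q_bil !normrM mulrA mulrC.
  rewrite ler_wpM2l// normfV normr_id (le_trans _ (uV n))//.
  by rewrite ler_piMr// ?invr_ge0// invf_le1.
have hY x y : Y y -> bil (h *m x) y = 0.
  move=> Yy; have [C CP] := SY _ Yy.
  apply: (@cluster_continuous_lim R _ _ v h (fun g => bil (g *m x) y)) => //.
    by apply: (@cvg_bil _ _ (nbhs h)); [exact: hcont|exact: cvg_cst].
  apply: (@cvg0_harmonic_bound _ (4 * `|x| * C)) => n.
  (* Cancelling [u n] in the form leaves the pairing of [x] with a bounded vector, divided by the
     norm of [u n]. *)
  have uy : y = u n *m (invmx (u n) *m y) by rewrite mulKVmx// O22_unitmx.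
  rewrite -scalemxAl bilZl [in bil _ y]uy O22_bil// normrM normfV normr_id mulrC.
  rewrite ler_pM ?invr_ge0// (le_trans (bil_le _ _))// ler_wpM2l ?mulr_ge0//.
  by apply: CP; exact: SV.
(* A nonzero column of [h] provides [w]. *)
have [j hj] : exists j, h *m delta_mx j 0 != 0 :> 'cV[R]_4.
  apply: contrapT => noj; suff h0 : h = 0.
    by move/eqP: h1; rewrite h0 normr0 eq_sym oner_eq0.
  apply/matrixP => i j; rewrite [RHS]mxE.
  have : h *m delta_mx j 0 = 0 :> 'cV[R]_4.
    by apply: contrapT => /eqP hj; apply: noj; exists j.
  by rewrite -colE => /matrixP/(_ i 0); rewrite !mxE.
by exists (h *m delta_mx j 0); split=> // y; exact: hY.
Qed.

End Dynamics.

Theorem theorem1p1 (R : realType) (L : set (set 'cV[R]_4))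
    (tL : set ('rV[R]_3 * R)) (G : set 'M[R]_4) :
  L `<=` Ein2 R ->
  cgn_achronal_lift L tL ->
  discrete_subgroup G (SO022 R) ->
  preserves_rays G L ->
  acts_properly_discontinuously G (invisible_domain tL).
Proof.
move=> _ [tLa tLcl _ [tLpast tLfut] tLL] [[GSO G1 GM GV] Giso] GL.
have GO : is_subgroup G (O22 R).
  by split=> // g /GSO; exact: connected_component_sub.
have tLc := achronal_compact tLa tLcl.
(* The empty set lies in every lightcone, so any boundary point contradicts nonelementarity. *)
have tL0 : tL !=set0.
  apply/set0P/eqP => tL0; apply: tLfut.
  exists (\row_i (i == 0)%:R, 0); last by rewrite tL0.
  by rewrite /Ein_cover /disk_boundary /sphere2 /= dot3E !mxE /=; split=> //; ring.
split=> [g x Gg xE|K Kc KE]; first exact: (invisible_domain_stable tLa tLc tL0 tLL GO GL).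
set S := [set g | _].
have [GO22 _ _ _] := GO.
have SG : S `<=` G by move=> g [].
apply: contrapT => Sinf.
(* Being infinite, [S] is unbounded by discreteness. It is stable under inversion because the
   inverse of [g] returns [g x] to [x]. *)
have [|g [Gg [x Kx Kgx]]|_ [b bL <-]|[M SM]|w [w0 Qw wY]] :=
    @unbounded_isotropic R S [set cover_vec b | b in tL].
- by move=> g [/GO22].
- split; first exact: GV.
  by exists (g *m x) => //; rewrite mulKmx// O22_unitmx//; exact: GO22.
- have [C CP] := returning_orbit_bounded tLa tLc tLL GO GL Kc KE bL.
  by exists C => g [Gg gK]; exact: CP.
- by apply: Sinf; apply: (discrete_bounded_finite _ SG SM).
have [b0 b0L] := tL0; have [tLE tLd] := tLa.
(* By achronality no angle of [tL] differs from [b0.2] by more than pi. *)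
apply: tLfut; apply: (@null_orthogonal_cone R tL w (b0.2 - pi)) => //.
  move=> a aL; have [[a1 _] [b1 _]] := (tLE _ aL, tLE _ b0L).
  have := le_trans (tLd _ _ aL b0L) (acos_lepi (dot3_bound a1 b1)).
  by rewrite ler_distl => /andP[].
by move=> a aL; apply: wY; exists a.
Qed.
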